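(* For $n\ge5$, every gapped-MCS in the Fibonacci word $f_n$ is an occurrence of the substring $101$ (which is also a maximal gapped repeat); that is, if $f_n[i..j]$ is a gapped-MCS then $f_n[i..j]=101$.
   Context: Fibonacci words are defined by $f_0=0$, $f_1=1$, $f_n=f_{n-1}f_{n-2}$ for $n\ge2$. Strings are indexed from 1; $w[i..j]$ denotes an occurrence. A gapped repeat in $w[1..N]$ is an occurrence $w[i..j]=uvu$ with $u,v$ nonempty; $u$ is its arm and $p=|u|+|v|$ its period. It is a maximal gapped repeat if it cannot be extended to the left or to the right by a symbol while preserving its period, i.e., ($i=1$ or $w[i-1]\ne w[i-1+p]$) and ($j=N$ or $w[j+1]\ne w[j+1-p]$). A border of a string $x$ is a nonempty string that is both a proper prefix and a proper suffix of $x$; $x$ is closed if $|x|=1$, or $|x|\ge2$ and $x$ has a border occurring in $x$ only as a prefix and as a suffix and nowhere else. A maximal gapped repeat that is also closed is called a gapped-MCS.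
   Formalization: A gapped-MCS is taken to be a maximal gapped repeat uvu whose arm u is itself the border making it closed; with an arbitrary closing border the claim fails, e.g. f_5[4..8]=10101=(1)(010)(1), closed by the border 101. *)

(* Defs.v *)
From mathcomp Require Import all_boot.

Set Implicit Arguments.
Unset Strict Implicit.
Unset Printing Implicit Defensive.

Fixpoint fib_word (n : nat) : seq nat :=
  match n with
  | 0 => [:: 0]
  | 1 => [:: 1]
  | (m.+1 as k).+1 => fib_word k ++ fib_word m
  end.

Section Strings.

Variable T : eqType.
Implicit Types (w x u v b : seq T) (i j k : nat).

(* Positions are numbered from 1, so [letter w k] is w[k] (as an option) for
   1 <= k, and [substring w i j] is w[i..j] for 1 <= i <= j <= size w. *)
Definition letter w k : option T := onth w k.-1.

Definition substring w i j : seq T := drop i.-1 (take j w).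

Definition border b x : Prop :=
  [/\ b <> [::], prefix b x, suffix b x & size b < size x].

(* The last condition says that every occurrence of b in x is the prefix one
   or the suffix one. *)
Definition closing_border b x : Prop :=
  border b x /\ forall s t, x = s ++ b ++ t -> s = [::] \/ t = [::].

Definition closed_string x : Prop :=
  size x = 1 \/ (2 <= size x /\ exists b, closing_border b x).

Definition gapped_repeat w i j u v : Prop :=
  [/\ 1 <= i <= j, j <= size w, u <> [::], v <> [::]
    & substring w i j = u ++ v ++ u].

Definition maximal_gapped_repeat w i j u v : Prop :=
  let p := size u + size v in
  [/\ gapped_repeat w i j u v,
      i = 1 \/ letter w (i - 1) <> letter w (i - 1 + p)
    & j = size w \/ letter w (j + 1) <> letter w (j + 1 - p)].

(* A gapped repeat carries its factorization uvu, and it is closed when its arm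
   u is a border that makes it closed. Equivalently (gapped_mcsE below), the
   string is closed and |u| + |v| is its smallest period. Without this link
   between arm and closedness, 10101 = (1)(010)(1) would qualify in f_5 although
   its smallest period is 2, so that it is a run. *)
Definition gapped_mcs w i j : Prop :=
  exists u v,
    maximal_gapped_repeat w i j u v /\ closing_border u (substring w i j).

Lemma closing_border_closed b x : closing_border b x -> closed_string x.
Proof.
move=> clx; right; split; last by exists b.
have [[b0 _ _ ltbx] _] := clx.
by apply: leq_ltn_trans ltbx; case: b b0 {clx}.
Qed.

Lemma prefix_border_cat b u x :
  prefix b x -> prefix u x -> size b <= size u -> exists r, u = b ++ r.
Proof.
rewrite !prefixE => /eqP bx /eqP ux leb; exists (drop (size b) u).
by rewrite -{1}(cat_take_drop (size b) u) -{1}ux take_takel // bx.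
Qed.

Lemma gapped_mcsE w i j :
  gapped_mcs w i j <->
  exists u v, [/\ maximal_gapped_repeat w i j u v, closed_string (substring w i j)
    & forall b, border b (substring w i j) -> size b <= size u].
Proof.
split=> -[u [v]].
  case=> mgr clu; exists u, v; split=> //; first exact: closing_border_closed clu.
  move=> b [_ pb /suffixP [s def_x] ltb]; rewrite leqNgt; apply/negP => ltub.
  have [[_ pu _ _] only] := clu.
  have [r def_b] := prefix_border_cat pu pb (ltnW ltub).
  case: (only s r); first by rewrite def_x def_b.
    by move=> s0; rewrite def_x s0 ltnn in ltb.
  by move=> r0; rewrite def_b r0 cats0 ltnn in ltub.
case=> mgr clx maxu; exists u, v; split=> //.
have [[_ _ u0 v0 def_x] _ _] := mgr.
have pu : prefix u (substring w i j) by rewrite def_x prefix_prefix.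
case: clx => [|[_ [b clb]]].
  by rewrite def_x !size_cat; case: u u0 {mgr maxu def_x pu}; case: v v0 => //=;
     move=> ? ? _ ? ? _; rewrite !addnS.
have [bb only] := clb; have [_ pb _ _] := bb.
have [r def_u] := prefix_border_cat pb pu (maxu _ bb).
case: (only (u ++ v) r); first by rewrite def_x -def_u catA.
  by case: u u0 {mgr maxu def_x pu def_u}.
by move=> r0; rewrite def_u r0 cats0.
Qed.

End Strings.

(* Main.v *)
(* The Fibonacci words are generated by the morphism 1 -> 10, 0 -> 1. In a
   maximal closed repeat x = z u = u y of [fib_word n.+1], maximality to the
   left forces u to begin with 1, and maximality to the right forces u to end
   with 1 or x to end the word. Hence x desubstitutes, with u = phi(u') 1 or
   u = phi(u'), to a maximal closed repeat of [fib_word n] with border u' and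
   period word z', z = phi(z'). If z' is a prefix of u' then z is a prefix of u,
   so the inequality |z| <= |u| propagates; it fails only for 101 and for the
   whole word f_4 = 10110. A gapped repeat is one with |z| > |u|. *)
Require Import Defs.
From mathcomp Require Import all_boot.

(** * The morphism and its synchronization *)

(* The letters above 1, which never occur, are sent to words that make the
   morphism injective on all of [seq nat]. *)
Definition fib_image (c : nat) : seq nat :=
  if c == 0 then [:: 1] else [:: 1; if c == 1 then 0 else c].

Definition fib_morph (w : seq nat) : seq nat := flatten (map fib_image w).

Lemma fib_morph_cat a b : fib_morph (a ++ b) = fib_morph a ++ fib_morph b.
Proof. by rewrite /fib_morph map_cat flatten_cat. Qed.

Lemma fib_morph_cons c w : fib_morph (c :: w) = fib_image c ++ fib_morph w.
Proof. by []. Qed.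

Lemma head_fib_morph w : head 1 (fib_morph w) = 1.
Proof. by case: w => [|[|c] w]. Qed.

Lemma fib_image_tail_neq1 c : (if c == 1 then 0 else c) <> 1.
Proof. by case: eqP. Qed.

Lemma fib_morph_nil w : fib_morph w = [::] -> w = [::].
Proof. by case: w => [|[|c] w]. Qed.

Lemma last_fib_morph a c : last 0 (fib_morph (rcons a c)) = last 0 (fib_image c).
Proof.
by rewrite -cats1 fib_morph_cat fib_morph_cons cats0 last_cat; case: c.
Qed.

(** Images begin with 1 and their second letters differ from 1, so the letter after the leading 1
    tells the image of 0 from the two-letter ones. *)
Lemma fib_morph_inj : injective fib_morph.
Proof.
elim=> [|c x IHx] [|d y] //; first by move/esym/fib_morph_nil.
  by move/fib_morph_nil.
have hx := head_fib_morph x; have hy := head_fib_morph y.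
rewrite !fib_morph_cons /fib_image.
case: (c =P 0) (d =P 0) => [->|c0] [->|d0] /=.
- by case=> /IHx ->.
- by case=> E; move: hx; rewrite E /= => /fib_image_tail_neq1.
- by case=> E; move: hy; rewrite -E /= => /fib_image_tail_neq1.
case=> E /IHx ->; congr (_ :: _); move: E c0 d0.
by do 2![case: eqP => [->|_]] => // <-.
Qed.

(* [head 1 b = 1] says that b is empty or begins with 1. *)
Lemma fib_morph_split x a b : fib_morph x = a ++ b -> head 1 b = 1 ->
  exists a' b', [/\ x = a' ++ b', fib_morph a' = a & fib_morph b' = b].
Proof.
elim: x a => [|c x IHx] a E hb.
  by case: a E => [|//]; case: b hb => // _ _; exists [::], [::].
case: a E => [|e a] E; first by exists [::], (c :: x).
move: E; rewrite fib_morph_cons /fib_image; case: (c =P 0) => [->|c0] /=.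
  case=> <- /IHx /(_ hb) [a' [b' [-> <- <-]]].
  by exists (0 :: a'), b'.
case: a => [|f a] /=.
  by case=> _ E; move: hb; rewrite -E => /fib_image_tail_neq1.
case=> <- <- /IHx /(_ hb) [a' [b' [-> <- <-]]].
exists (c :: a'), b'; split=> //.
by rewrite fib_morph_cons /fib_image; case: (c =P 0).
Qed.

(** A letter other than 1 can only be the second letter of an image, and the first letter is 1. *)
Lemma last_before_neq1 x a c b :
  fib_morph x = a ++ c :: b -> c <> 1 -> last 0 a = 1.
Proof.
elim: x a => [|d x IHx] a E c1; first by case: a E.
have hx := head_fib_morph x.
have step a1 : fib_morph x = a1 ++ c :: b -> last 0 a1 = 1 /\ a1 <> [::].
  move=> E1; split; first exact: IHx E1 c1.
  by case: a1 E1 => // E1; move: hx; rewrite E1.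
move: E; rewrite fib_morph_cons /fib_image; case: (d =P 0) => [_|d0] /=.
  case: a => [[/esym//]|e a [<- /step[]]].
  by case: a.
case: a => [[/esym//]|e [[<-//]|f a [<- _ /step[]]]].
by case: a.
Qed.

(** * Fibonacci words as iterates of the morphism, and their suffixes *)

Lemma fib_wordS n : fib_word n.+1 = fib_morph (fib_word n).
Proof.
have [] : fib_word n.+1 = fib_morph (fib_word n) /\
          fib_word n.+2 = fib_morph (fib_word n.+1) => //.
elim: n => // n [IH1 IH2]; split=> //.
have -> : fib_word n.+3 = fib_word n.+2 ++ fib_word n.+1 by [].
by rewrite {2}[fib_word n.+2]/= -/(fib_word n.+1) fib_morph_cat -IH1 -IH2.
Qed.

Lemma fib_word_binary n : all (leq^~ 1) (fib_word n).
Proof.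
have [] : all (leq^~ 1) (fib_word n) /\ all (leq^~ 1) (fib_word n.+1) => //.
elim: n => // n [IH1 IH2]; split=> //.
have -> : fib_word n.+2 = fib_word n.+1 ++ fib_word n by [].
by rewrite all_cat IH1 IH2.
Qed.

(** Each Fibonacci word ends with the one two steps earlier, so questions on short suffixes reduce
    to [fib_word 5] and [fib_word 6]. *)
Lemma fib_word_suffix k :
  exists s, fib_word (k + 5) = s ++ fib_word (odd k + 5).
Proof.
have [] : (exists s, fib_word (k + 5) = s ++ fib_word (odd k + 5)) /\
  (exists s, fib_word (k.+1 + 5) = s ++ fib_word (odd k.+1 + 5)) => //.
elim: k => [|k [[s IH1] IH2]]; first by split; exists [::].
split=> //; exists (fib_word (k.+1 + 5) ++ s).
by rewrite -catA /= negbK -IH1.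
Qed.

Lemma fib_word_end10110 n s :
  fib_word n = s ++ [:: 1; 0; 1; 1; 0] -> s = [::] \/ last 0 s = 1.
Proof.
case/lastP: s => [|s c]; first by left.
right; rewrite last_rcons; case: (ltnP n 5) => n5 in H *.
  have := congr1 size H; rewrite size_cat size_rcons /= !addnS.
  by case: n n5 {H} => [|[|[|[|[|n]]]]].
move: H; have [g] := fib_word_suffix (n - 5); rewrite subnK // => ->.
(* In reversed order, index 0 excludes [fib_word 5], which ends with 1, and index 5 reads [c] off
   [fib_word 6], which ends with 110110. *)
by case: (odd _) => /(congr1 (fun w => (nth 0 (rev w) 0, nth 0 (rev w) 5)));
  rewrite !rev_cat rev_rcons => -[].
Qed.

(** * Maximal closed repeats and borders *)

(* The two occurrences of u in x = z u = u y are preceded by the last letters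
   of s and z, and followed by the first letters of y and t. *)
Definition maximal_closed_repeat (w s z u y t : seq nat) : Prop :=
  [/\ w = s ++ z ++ u ++ t, z ++ u = u ++ y, z <> [::] & u <> [::]] /\
  [/\ forall a b, z ++ u = a ++ u ++ b -> a = [::] \/ b = [::],
      s = [::] \/ last 0 s <> last 0 z
    & t = [::] \/ head 0 t <> head 0 y].

Lemma border_short (z u y : seq nat) :
  z ++ u = u ++ y -> size z <= size u -> exists r, u = z ++ r.
Proof.
move=> E le_zu; exists (drop (size z) u).
have := congr1 (take (size z)) E; rewrite take_size_cat // takel_cat // => {1}->.
by rewrite cat_take_drop.
Qed.

(** Images of letters differ in length, so the inequality carries over only because [z] is a prefix
    of [u]. *)
Lemma fib_morph_border_le (z u y : seq nat) :
  z ++ u = u ++ y -> size z <= size u ->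
  size (fib_morph z) <= size (fib_morph u).
Proof.
move=> E /(border_short _ _ _ E) [r ->].
by rewrite fib_morph_cat size_cat leq_addr.
Qed.

(** The last letter of a word determines that of its image, so a mismatch between the images comes
    from one between the words. *)
Lemma left_maximal_fib_morph s z : z <> [::] ->
  fib_morph s = [::] \/ last 0 (fib_morph s) <> last 0 (fib_morph z) ->
  s = [::] \/ last 0 s <> last 0 z.
Proof.
case/lastP: z => // z d _; case/lastP: s => [|s c]; first by left.
rewrite !last_fib_morph !last_rcons => -[/fib_morph_nil|ne]; last first.
  by right=> cd; rewrite cd in ne.
by case: s.
Qed.

Lemma border101 (z u y : seq nat) :
  z <> [::] -> u <> [::] -> z ++ u = u ++ y -> z ++ u = [:: 1; 0; 1] ->
  z = [:: 1; 0] /\ u = [:: 1].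
Proof.
move=> z0 u0 Ey E; rewrite E in Ey; move: z0 u0 E Ey.
case: z => [|a [|b [|c z]]] //= _ u0; try by case=> -> -> ->.
  by case=> _ ->.
by case=> _ _ _; case: z; case: (u) u0.
Qed.

Lemma border10110 (z u y : seq nat) :
  z <> [::] -> u <> [::] -> z ++ u = u ++ y -> z ++ u = [:: 1; 0; 1; 1; 0] ->
  z = [:: 1; 0; 1] /\ u = [:: 1; 0].
Proof.
move=> z0 u0 Ey E; rewrite E in Ey; move: z0 u0 E Ey.
case: z => [|a [|b [|c [|d [|e z]]]]] //= _ u0; try by case=> -> -> -> ->.
- by case=> _ ->.
- by case=> _ _ ->.
- by case=> _ _ _ _ ->.
by case=> _ _ _ _ _; case: z; case: (u) u0.
Qed.

(** * Induction by desubstitution *)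

Lemma maximal_closed_repeat_fib n s z u y t :
  maximal_closed_repeat (fib_word n) s z u y t ->
  [\/ size z <= size u, z ++ u = [:: 1; 0; 1]
    | z ++ u = [:: 1; 0; 1; 1; 0] /\ fib_word n = [:: 1; 0; 1; 1; 0]].
Proof.
elim: n s z u y t => [|n IHn] s z u y t [[Ew Ey z0 u0] [clos lmax rmax]].
  have := congr1 size Ew; rewrite !size_cat.
  by case: z u z0 u0 {Ew Ey clos lmax rmax} => [|? ?] [|? ?] // _ _;
    rewrite /= !(addSn, addnS).
have sz_y : size y = size z.
  by have /eqP := congr1 size Ey; rewrite !size_cat addnC eqn_add2l => /eqP.
have y0 : y <> [::] by move=> yn; move: sz_y z0; rewrite yn; case: (z).
have Ew' := Ew; rewrite fib_wordS in Ew'.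
have Eu : fib_morph (fib_word n) = s ++ u ++ y ++ t 
  by rewrite Ew' (catA u) -Ey !catA.
(* Otherwise 1 precedes both occurrences of [u], against left maximality; as [last 0 [::]] is 0, an
   empty [s] is excluded too. *)
have hu : head 1 u = 1.
  case: u u0 Eu Ew' {Ew Ey clos} => //= c u _ Eu Ew'.
  case: (c =P 1) => // c1; have ls := last_before_neq1 _ _ _ _ Eu c1.
  have := last_before_neq1 (fib_word n) (s ++ z) c (u ++ t).
  rewrite -catA Ew' => /(_ erefl c1).
  rewrite last_cat; case: z z0 lmax {Ew' sz_y} => //= d z _ lmax lz.
  by case: lmax => [s0|]; [rewrite s0 in ls | rewrite ls lz].
have hz : head 1 (z ++ u ++ t) = 1 /\ head 1 (u ++ t) = 1.
  split; last by case: (u) u0 hu.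
  by rewrite catA Ey; case: (u) u0 hu.
have [s' [r [Er Es]]] := fib_morph_split _ _ _ Ew' hz.1.
case/fib_morph_split => [|z' [r' [Er' Ez Er'']]]; first exact: hz.2.
subst r s z; have z'0 : z' <> [::] by move=> zn; apply: z0; rewrite zn.
have lmax' := left_maximal_fib_morph _ _ z'0 lmax.
(* Either x ends the word and [y] begins with 1, so that [u] is itself an image, or some occurrence
   of [u] is followed by a letter other than 1, so that [u] ends with 1. *)
case: (boolP ((t == [::]) && (head 1 y == 1))) => [/andP[/eqP t0 /eqP hy]|tyN].
  subst t; rewrite cats0 in Er''; subst u.
  have := Ey; rewrite -fib_morph_cat.
  case/fib_morph_split => // u2 [y' [Ey' /fib_morph_inj Eu2 Eyy]]; subst u2 y.
  have u'0 : r' <> [::] by move=> rn; apply: u0; rewrite rn.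
  case: (IHn s' z' r' y' [::]) => [|le|E|[E En]].
  - split; split=> //; [by rewrite cats0| |by left].
    move=> a b /(congr1 fib_morph); rewrite !fib_morph_cat => /clos.
    by case=> /fib_morph_nil; [left|right].
  - by constructor 1; apply: fib_morph_border_le Ey' le.
  (* Now x = 10110 ends the word and [z] = 101 ends with 1, so left maximality leaves only an empty
     [s]. *)
  - have [Ez' Er'1] := border101 _ _ _ z'0 u'0 Ey' E; subst z' r'.
    case: (fib_word_end10110 n.+1 (fib_morph s')) => [||ls] //.
      by move=> sn; constructor 3; rewrite Ew sn.
    by case: lmax => [sn|]; [rewrite sn in ls | rewrite ls].
  - have [Ez' Er'1] := border10110 _ _ _ z'0 u'0 Ey' E; subst z' r'.
    (* A third occurrence of [u] = 101 shows in x = 101 101 01. *)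
    by case: (clos (fib_morph [:: 1; 0]) [:: 0; 1]).
have [u1 def_u] : exists u1, u = u1 ++ [:: 1].
  have : last 0 u = 1.
    suff [a [c [b [a0 c1]]]] : exists a c b,
        [/\ last 0 a = last 0 u, c <> 1 & fib_morph (fib_word n) = a ++ c :: b].
      by move/last_before_neq1/(_ c1); rewrite a0.
    have lcat a : last 0 (a ++ u) = last 0 u.
      by rewrite last_cat; case/lastP: (u) u0 => // ? ? _; rewrite !last_rcons.
    have [c1|hy] := eqVneq (head 1 y) 1; last first.
      case: (y) y0 hy Eu => // c b _ /eqP hy Eu.
      by exists (fib_morph s' ++ u), c, (b ++ t); rewrite lcat Eu -!catA.
    case: t tyN rmax Ew' {Ew Eu hz Er''} => [|c b]; first by rewrite c1.
    move=> _ rmax Ew'; exists (fib_morph s' ++ fib_morph z' ++ u), c, b.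
    rewrite catA lcat Ew' -!catA; split=> // c1'; case: rmax => //= rmax.
    by apply: rmax; rewrite c1' -c1; case: (y) y0.
  by case/lastP: (u) u0 => // u1 c _; rewrite last_rcons => ->; exists u1; rewrite cats1.
subst u; rewrite -catA in Er''.
(* The cut is made before the last letter of [u]: phi(q) = 1 t, so [q] is nonempty even when [t] is
   empty. *)
have [//|u' [q [Er' Eu' Eq]]] := fib_morph_split _ _ _ Er''; subst r' u1.
have : fib_morph (z' ++ u' ++ q) = fib_morph u' ++ 1 :: y ++ t.
  by rewrite fib_morph_cat Er''; have := congr1 (cat^~ t) Ey; rewrite -!catA.
case/fib_morph_split => // u2 [r2 [Er2 /fib_morph_inj Eu2 Eyt]]; subst u2.
have [y' Ey'] : exists y', z' ++ u' = u' ++ y'.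
  exists (drop (size u') (z' ++ u')).
  have := congr1 (take (size u')) Er2.
  rewrite catA takel_cat ?size_cat ?leq_addl // [RHS]take_size_cat // => E2.
  by rewrite -{1}(cat_take_drop (size u') (z' ++ u')) E2.
have Er2' : r2 = y' ++ q.
  by move/eqP: Er2; rewrite catA Ey' -catA eqseq_cat // eqxx /= eq_sym => /eqP.
subst r2.
(* If [u] = 1, closedness leaves a single letter in [z'], since every image begins with 1; so [z] is
   1 or 10. *)
have [u'0|u'0] := eqVneq u' [::].
  subst u'; rewrite /= in clos *.
  have bz : all (leq^~ 1) z'.
    by have := fib_word_binary n; rewrite Er !all_cat => /and3P[].
  case: z' z'0 bz clos {Ew z0 Ey Ey' Er Ew' Eu hz lmax lmax' sz_y Er2 Eyt} => // c z'.
  move=> _ /andP[bc _] clos; case: z' clos => [|d z'] clos.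
    by case: c bc clos => [|[|]] // _ _; [constructor 1 | constructor 2].
  have [a Ea] : exists a, fib_morph (d :: z') = 1 :: a.
    by exists (behead (fib_image d) ++ fib_morph z'); case: (d).
  rewrite fib_morph_cons Ea in clos.
  case: (clos (fib_image c) (a ++ [:: 1])); rewrite -?catA //.
    by case: (c).
  by case: (a).
have {}u'0 : u' <> [::] by apply/eqP.
case: (IHn s' z' u' y' q) => [|le|E|[E En]].
- have q0 : q <> [::] by move=> qn; rewrite qn in Eq.
  split; split=> // [a b Ex|].
    (* An occurrence of [u'] yields one of [u] = phi(u') 1, because phi(b) 1 begins with 1. *)
    have [b2 Eb] : exists b2, fib_morph b ++ [:: 1] = 1 :: b2.
      by case: (b) (head_fib_morph b) => [|[|c] b'] _; eexists.
    case: (clos (fib_morph a) b2); last first.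
    - move=> b20; right; case: b Eb {Ex} => // c b.
      by rewrite b20 fib_morph_cons /fib_image; case: eqP; case: (fib_morph b).
    - by move/fib_morph_nil; left.
    by rewrite catA -fib_morph_cat Ex !fib_morph_cat -!catA Eb.
  (* Let [q] and [y'] share their first letter [c]. If [c] is 0, [y] begins with 1 and [t] is empty
     or begins with 1; otherwise [t] and [y] both begin with the second letter of phi(c). *)
  right=> hq; case: y' Ey' Eyt hq {Er2} => [|d y'] Ey' Eyt.
    by move/(congr1 size): Ey' z'0 => /eqP; rewrite !size_cat addnC eqn_add2l; case: (z').
  case: q q0 Eq Eyt {Er Er''} => // c q _ Eq Eyt /= cd; subst d.
  move: Eq Eyt; rewrite cat_cons !fib_morph_cons /fib_image.
  case: (c =P 0) => [_|c0] [Eq] [Eyt].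
    have hy : head 1 y = 1.
      by have := head_fib_morph (y' ++ c :: q); rewrite Eyt; case: (y) y0.
    have ht := head_fib_morph q; rewrite Eq in ht.
    case: t tyN rmax ht {Ew Ew' Eu hz Eq Eyt} => [|e t]; first by rewrite hy.
    by move=> _ [//|ne] /= e1; case: ne; case: (y) y0 hy => //= ? ? _ ->.
  case: rmax => [tn|]; first by rewrite tn in Eq.
  by rewrite -Eq; case: (y) y0 Eyt => //= ? ? _ [->].
- constructor 1; rewrite size_cat.
  exact: leq_trans (fib_morph_border_le _ _ _ Ey' le) (leq_addr _ _).
(* Both [z] and [u] become 101. *)
- by have [-> ->] := border101 _ _ _ z'0 u'0 Ey' E; constructor 1.
(* As [q] is nonempty, z' u' is not the whole word. *)
exfalso; have := congr1 size Er; rewrite En -E !size_cat.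
case: q Eq {Er Er'' Er2 Eyt} => // c q _ /eqP.
apply/negP; rewrite neq_ltn (addnA (size z')) addnCA -[X in X < _]addn0.
by rewrite ltn_add2l addnS.
Qed.

(** * From positions to factorizations *)

Lemma letter_cat (a b : seq nat) c k :
  k = (size a).+1 -> letter (a ++ c :: b) k = Some c.
Proof. by move=> ->; rewrite /letter /=; elim: a. Qed.

Theorem theorem6 (n i j : nat) (hn : 5 <= n)
  (h : gapped_mcs (fib_word n) i j) :
  substring (fib_word n) i j = [:: 1; 0; 1].
Proof.
have [u [v [[[/andP[i1 ij] jn u0 v0 Ex] lmax rmax] [_ clos]]]] := h.
set w := fib_word n in jn Ex lmax rmax clos *.
pose s := take i.-1 w; pose t := drop j w.
have le_ij : i.-1 <= j by rewrite (leq_trans (leq_pred i)).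
have Es : take i.-1 (take j w) = s by rewrite take_takel.
have Ew : w = s ++ substring w i j ++ t by rewrite catA -Es !cat_take_drop.
have sz_s : size s = i.-1 by rewrite size_takel // (leq_trans le_ij).
have sz_x : i.-1 + size (u ++ v ++ u) = j.
  have := congr1 size (cat_take_drop i.-1 (take j w)).
  by rewrite -Ex size_cat Es sz_s size_takel.
have : maximal_closed_repeat w s (u ++ v) u (v ++ u) t.
  split; first split=> //.
  - by rewrite Ew Ex -!catA.
  - by rewrite -!catA.
  - by case: (u) u0.
  split.
  - by move=> a b; rewrite -catA -Ex => /clos.
  (* With p = |u| + |v|, [s] ends at position i - 1 and the period word u v at i - 1 + p. *)
  - case: lmax => [i1'|lmax]; first by left; apply: size0nil; rewrite sz_s i1'.
    case/lastP: s sz_s Ew {Es} => [|s c] sz_s Ew; first by left.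
    right; rewrite last_rcons => eq_c; apply: lmax.
    have [z [d Euv]] : exists z d, u ++ v = rcons z d.
      by case/lastP Euv: (u ++ v) => [|z d]; [case: (u) u0 Euv | exists z, d].
    have sz_z : size u + size v = (size z).+1 by rewrite -size_cat Euv size_rcons.
    move: eq_c; rewrite Euv last_rcons => Ec; subst d.
    rewrite size_rcons in sz_s; rewrite subn1 -sz_s sz_z Ew.
    rewrite [LHS](_ : _ = Some c); last by rewrite cat_rcons letter_cat.
    rewrite Ex (catA u) Euv (cat_rcons c z) -!catA /= catA letter_cat //.
    by rewrite size_cat size_rcons addnS.
  (* Here [t] starts at j + 1 and v u at j + 1 - p. *)
  - case: rmax => [jw|rmax]; first by left; rewrite /t jw drop_size.
    case Et: t Ew => [|c t1] Ew; [by left | right => /= eq_c; apply: rmax].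
    case Evu: (v ++ u) eq_c => [|d y]; first by case: (v) v0 Evu.
    move=> /= eq_c; subst d; rewrite Ew.
    rewrite [LHS](_ : _ = Some c); last first.
      by rewrite catA; apply: letter_cat; rewrite size_cat sz_s Ex sz_x addn1.
    rewrite Ex Evu -catA /= catA letter_cat // size_cat sz_s -sz_x !size_cat.
    rewrite (addnC (size v)) !addnA -(addnA _ (size u) (size v)) addn1.
    by rewrite subSn ?leq_addl // addnK.
case/maximal_closed_repeat_fib; rewrite -?catA -?Ex //.
  rewrite size_cat -[X in _ <= X]addn0 leq_add2l; by case: (v) v0.
(* The suffix [fib_word 5] or [fib_word 6] already has 8 letters, too many for 10110. *)
case=> _ Ew5; have : 8 <= size w.
  have [g] := fib_word_suffix (n - 5); rewrite subnK // /w => ->.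
  by rewrite size_cat; case: (odd _); rewrite addnC.
by rewrite /w Ew5.
Qed.
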